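(* Let $r\ge1$ be an integer, let $\varepsilon_r$ be any real number with $\varepsilon_r\ge\sup_{t\in[0,\bar g]}|f(t)-f_r^{\mathrm{ch}}(t)|$, and define $$p_r(t):=\frac{|w|+m}{m}\bigl(f_r^{\mathrm{ch}}(t)+\varepsilon_r\bigr),\qquad v_r^{\mathrm{ch},+}:=V_r+2^n\frac{|w|+m}{m}\varepsilon_r .$$ Then: (i) (Feasibility) $p_r(t)\ge\frac{|w|+m}{m}(1-t)_+$ for all $t\in[0,\bar g]$; equivalently $p_r(t)\ge\frac{|w|+m}{m}(1-t)$ on $[0,1]$ and $p_r\ge0$ on $[0,\bar g]$. Hence, with $q^\star(t)=\frac{|w|+m}{m}\bigl(t-\frac{|w|}{|w|+m}\bigr)$, one has $p_r+q^\star\ge1$ on $[0,1]$ and $p_r\ge0$ on $[0,\bar g]$, i.e. $p_r$ is feasible for the order-$r$ Stokes relaxation (S). (ii) (SOS certificates) There are sums of squares of univariate polynomials $\sigma_0,\tau_0$ of degree at most $2r$ and $\sigma_1,\tau_1$ of degree at most $2r-2$ such that $$p_r=\sigma_0+t(\bar g-t)\,\sigma_1,\qquad p_r-\tfrac{|w|+m}{m}(1-t)=\tau_0+t(1-t)\,\tau_1 .$$ (iii) (Value) $2^n\int_0^{\bar g}p_r\,d\nu=V_r+2^n\frac{|w|+m}{m}\varepsilon_r=v_r^{\mathrm{ch},+}$. Consequently $\operatorname{vol}K\le v_r^{\mathrm{ch},+}$, and the optimal value $d_r^{\mathrm{sos}}$ of (S) satisfies $$\operatorname{vol}K\le 2^n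 d_r^{\mathrm{sos}}\le v_r^{\mathrm{ch},+}.$$
   Context: Setting: $n,m\ge1$ are integers, $w=(w_1,\dots,w_n)$ is a vector of positive integers and $|w|:=\sum_i w_i$. $g:\mathbb{R}^n\to[0,\infty)$ is a polynomial with $g(t^{w_1}x_1,\dots,t^{w_n}x_n)=t^m g(x)$ for all $t>0$, $x\in\mathbb{R}^n$, and $g(x)>0$ for $x\ne0$. Let $B:=[-1,1]^n$ and $K:=\{x\in\mathbb{R}^n: g(x)\le1\}$; it is assumed that $K\subseteq B$. Let $\bar g:=\max_{x\in B}g(x)$; it is assumed that $\bar g>1$. Let $\mu$ be the uniform probability measure on $B$ and $\nu:=g_\#\mu$ its pushforward under $g$, a probability measure on $[0,\bar g]$. Chebyshev construction: $f(t)=(1-t)_+=\max(0,1-t)$ on $[0,\bar g]$; $T_k$ is the Chebyshev polynomial of the first kind; $c_k:=\frac2\pi\int_{-1}^1 f\bigl(\tfrac{\bar g}{2}(s+1)\bigr)T_k(s)(1-s^2)^{-1/2}ds$; $f_r^{\mathrm{ch}}(t):=\frac{c_0}{2}+\sum_{k=1}^r c_kT_k\bigl(\tfrac{2t}{\bar g}-1\bigr)$; $y_k^{\mathrm{ch}}:=\int_0^{\bar g}T_k\bigl(\tfrac{2t}{\bar g}-1\bigr)d\nu(t)$; and $V_r:=\frac{2^n(|w|+m)}{m}\bigl(\frac{c_0}{2}+\sum_{k=1}^r c_k y_k^{\mathrm{ch}}\bigr)$. Order-$r$ Stokes relaxation (S): minimize $\int p\,d\nu$ over polynomials $p\in\mathbb{R}[t]$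 of degree at most $2r$ subject to $p(t)\ge\frac{|w|+m}{m}(1-t)$ on $[0,1]$ and $p(t)\ge0$ on $[0,\bar g]$. Its optimal value is $d_r^{\mathrm{sos}}$. *)

(* Defs.v *)
From HB Require Import structures.
From mathcomp Require Import all_boot all_order all_algebra.
From mathcomp Require Import all_classical all_reals all_analysis.
From mathcomp Require Import measurable_realfun.
(* Not imported: its notations clash with those of mathcomp-analysis. *)
From mathcomp Require mpoly.

Set Implicit Arguments.
Unset Strict Implicit.
Unset Printing Implicit Defensive.
Import Order.TTheory GRing.Theory Num.Theory.
Import numFieldNormedType.Exports.
Local Open Scope classical_set_scope.
Local Open Scope ring_scope.

(* Points of R^n are n-tuples, which carry the product Borel sigma-algebra.
   Lebesgue measure on R^(n+1) is the image under cons of the product of the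
   Lebesgue measures on R and R^n; on the one-point space R^0 it is the unit
   mass. *)

Section lebesgue_cons.
Local Open Scope ereal_scope.
Context {R : realType} (n : nat).

Definition tcons (p : measurableTypeR R * n.-tuple R) : n.+1.-tuple R :=
  [tuple of (p.1 : R) :: p.2].

Let measurable_tcons : measurable_fun [set: _] tcons.
Proof.
apply: (@measurable_cons _ _ _ _ (fun p => p.1 : R) n snd).
- exact: measurable_fst.
- exact: measurable_snd.
Qed.

HB.instance Definition _ := isMeasurableFun.Build _ _ _ _ _ measurable_tcons.

Variable m : {sigma_finite_measure set (n.-tuple R) -> \bar R}.

Definition lebesgue_cons : set (n.+1.-tuple R) -> \bar R :=
  pushforward (@lebesgue_measure R \x m) tcons.

Let lebesgue_cons0 : lebesgue_cons set0 = 0.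
Proof. by rewrite /lebesgue_cons /pushforward preimage_set0 measure0. Qed.

Let lebesgue_cons_ge0 A : 0 <= lebesgue_cons A.
Proof. exact: measure_ge0. Qed.

Let lebesgue_cons_sigma_additive : semi_sigma_additive lebesgue_cons.
Proof. exact: measure_semi_sigma_additive. Qed.

HB.instance Definition _ := isMeasure.Build _ _ _ lebesgue_cons
  lebesgue_cons0 lebesgue_cons_ge0 lebesgue_cons_sigma_additive.

Let preimage_tcons (A : set R) (B : set (n.-tuple R)) :
  tcons @^-1` [set x | A (thead x) /\ B [tuple of behead x]] = A `*` B.
Proof.
apply/seteqP; split => -[a b]; rewrite /tcons/= theadE;
  by rewrite (_ : [tuple of behead (_ :: _)] = b)//; exact/val_inj.
Qed.

Lemma measurable_tuple_box (A : set R) (B : set (n.-tuple R)) :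
  measurable A -> measurable B ->
  measurable [set x : n.+1.-tuple R | A (thead x) /\ B [tuple of behead x]].
Proof.
move=> mA mB; apply: measurableI.
- rewrite -[X in measurable X]setTI.
  exact: (@measurable_tnth _ _ _ ord0 measurableT A mA).
- rewrite -[X in measurable X]setTI.
  exact: (@measurable_behead _ R n measurableT B mB).
Qed.

Lemma lebesgue_cons_box (A : set R) (B : set (n.-tuple R)) :
  measurable A -> measurable B ->
  lebesgue_cons [set x | A (thead x) /\ B [tuple of behead x]] =
  lebesgue_measure A * m B.
Proof.
move=> mA mB.
by rewrite /lebesgue_cons /pushforward preimage_tcons product_measure1E.
Qed.

Let lebesgue_cons_sigma_finite : sigma_finite setT lebesgue_cons.
Proof.
have /sigma_finiteP[F [TF ndF Foo]] := sigma_finiteT (@lebesgue_measure R).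
have /sigma_finiteP[G [TG ndG Goo]] := sigma_finiteT m.
exists (fun k => [set x | F k (thead x) /\ G k [tuple of behead x]]).
  apply/esym; rewrite -subTset => x _.
  have [i _ Fi] : (\bigcup_i F i) (thead x) by rewrite -TF.
  have [j _ Gj] : (\bigcup_i G i) [tuple of behead x] by rewrite -TG.
  exists (maxn i j) => //; split.
    by move: Fi; exact/subsetPset/ndF/leq_maxl.
  by move: Gj; exact/subsetPset/ndG/leq_maxr.
move=> k; have [mF Fk] := Foo k; have [mG Gk] := Goo k.
split; first exact: measurable_tuple_box.
by rewrite lebesgue_cons_box// lte_mul_pinfty// ge0_fin_numE.
Qed.

HB.instance Definition _ := Measure_isSigmaFinite.Build _ _ _ lebesgue_cons
  lebesgue_cons_sigma_finite.

End lebesgue_cons.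

Fixpoint lebesgue_tuple (R : realType) (n : nat) :
    {sigma_finite_measure set (n.-tuple R) -> \bar R} :=
  match n with
  | 0 => @dirac _ (0.-tuple R) [tuple] R
  | k.+1 => lebesgue_cons (lebesgue_tuple R k)
  end.

Lemma measurable_box (R : realType) (n : nat) (A : 'I_n -> set R) :
  (forall i, measurable (A i)) ->
  measurable [set x : n.-tuple R | forall i, A i (tnth x i)].
Proof.
move=> mA; rewrite [X in measurable X](_ : _ =
  \bigcap_(i in [set: 'I_n]) ((fun x : n.-tuple R => tnth x i) @^-1` A i)).
  apply: (@fin_bigcap_measurable _ (n.-tuple R)) => [|i _];
    first exact: finite_finset.
  by have := @measurable_tnth _ _ _ i measurableT _ (mA i); rewrite setTI.
by apply/seteqP; split => x /= Ax i; [move=> _|]; exact: Ax.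
Qed.

Lemma lebesgue_tuple_box (R : realType) (n : nat) (A : 'I_n -> set R) :
  (forall i, measurable (A i)) ->
  lebesgue_tuple R n [set x | forall i, A i (tnth x i)] =
  (\prod_(i < n) lebesgue_measure (A i))%E.
Proof.
elim: n A => [|n IHn] A mA.
  by rewrite big_ord0 /= diracE mem_set//= => -[].
rewrite big_ord_recl -(IHn (fun i => A (lift ord0 i)))//=.
have mB := @measurable_box R n (fun i => A (lift ord0 i)) (fun i => mA _).
rewrite -(lebesgue_cons_box (lebesgue_tuple R n) (mA ord0) mB).
congr lebesgue_cons; apply/seteqP; split => x /=.
  move=> Ax; split; first exact: Ax.
  by move=> i; have := Ax (lift ord0 i); rewrite {1}(tuple_eta x) tnthS.
move=> [A0 AS] i; have [->|i0] := eqVneq i ord0; first exact: A0.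
have [j ->] : exists j, i = lift ord0 j.
  by case: (unliftP ord0 i) i0 => [j ->|->]; [exists j|rewrite eqxx].
suff -> : tnth x (lift ord0 j) = tnth [tuple of behead x] j by exact: AS.
by rewrite {1}(tuple_eta x) tnthS.
Qed.

Definition cube (R : realType) (n : nat) : set (n.-tuple R) :=
  [set x | forall i, tnth x i \in `[-1, 1]].
Arguments cube : clear implicits.

Lemma measurable_cube (R : realType) (n : nat) : measurable (cube R n).
Proof.
exact: (@measurable_box R n (fun=> `[-1, 1]%classic)).
Qed.
Arguments measurable_cube : clear implicits.

(* The second argument of mnormalize is only used for measures of total mass 0
   or +oo, which is not the case here since the cube has volume 2^n. *)
Definition uniform_cube (R : realType) (n : nat) : probability (n.-tuple R) R :=
  mnormalize (mrestr (lebesgue_tuple R n) (measurable_cube R n))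
    \d_([tuple 0 | _ < n] : n.-tuple R).

Lemma lebesgue_cube (R : realType) (n : nat) :
  lebesgue_tuple R n (cube R n) = (2 ^+ n)%:E.
Proof.
rewrite (@lebesgue_tuple_box R n (fun=> `[-1, 1]%classic))//.
rewrite (eq_bigr (fun=> (2 : R)%:E)) => [|i _].
  by rewrite big_const_ord; elim: n => [|n IHn]//=; rewrite IHn exprS EFinM.
by rewrite lebesgue_measure_itv/= lte_fin (lt_trans (ltrN10 R) ltr01) -EFinB opprK.
Qed.

Lemma uniform_cubeE (R : realType) (n : nat) (A : set (n.-tuple R)) :
  uniform_cube R n A =
  (lebesgue_tuple R n (A `&` cube R n) * ((2 ^+ n)^-1)%:E)%E.
Proof.
rewrite /uniform_cube /= /mnormalize /= /mrestr setTI lebesgue_cube eqe.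
by rewrite expf_eq0 pnatr_eq0 andbF.
Qed.

Definition mpeval (R : realType) (n : nat) (g : mpoly.mpoly n R)
  (x : n.-tuple R) : R := mpoly.meval (tnth x) g.

Lemma measurable_mpeval (R : realType) (n : nat) (g : mpoly.mpoly n R) :
  measurable_fun setT (mpeval g).
Proof.
rewrite (_ : mpeval g = fun x => \sum_(m <- mpoly.msupp g)
    mpoly.mcoeff m g * \prod_(i < n) tnth x i ^+ mpoly.fun_of_multinom m i).
  apply: measurable_sum => m; apply: measurable_funM => //.
  apply: measurable_prod => i _.
  by apply/measurable_funX; exact: measurable_tnth.
by apply/funext => x; exact: mpoly.mevalE.
Qed.

HB.instance Definition _ (R : realType) (n : nat) (g : mpoly.mpoly n R) :=
  isMeasurableFun.Build _ _ _ _ (mpeval g) (measurable_mpeval g).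

Fixpoint chebT (R : realType) (k : nat) : {poly R} :=
  match k with
  | 0 => 1
  | k1.+1 => match k1 with
             | 0 => 'X
             | k2.+1 => 2 *: 'X * chebT R k1 - chebT R k2
             end
  end.

Definition hinge (R : realType) (t : R) : R := Num.max 0 (1 - t).

Section stokes.
Context (R : realType) (n : nat) (w : 'I_n -> nat) (m : nat).
Variable g : mpoly.mpoly n R.
Implicit Types (r k : nat) (p : {poly R}) (eps t s : R).

Definition weight : nat := (\sum_(i < n) w i)%N.

Definition sublevel : set (n.-tuple R) := [set x | mpeval g x <= 1].

(* This supremum is a maximum: g is continuous and the cube is compact. *)
Definition gbar : R := sup (mpeval g @` cube R n).

Definition nu : probability R R := distribution (uniform_cube R n) (mpeval g).

Definition stokes_cst : R := (weight + m)%:R / m%:R.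

(* At s = -1 and s = 1 the factor (1 - s^2)^(-1/2) evaluates to 0^-1 = 0, which
   does not affect the integral. *)
Definition cheb_coef k : R :=
  2 / pi * \int[lebesgue_measure]_(s in `[-1, 1])
    (hinge (gbar / 2 * (s + 1)) * (chebT R k).[s]
     * (Num.sqrt (1 - s ^+ 2))^-1).

Definition cheb_shift k : {poly R} :=
  chebT R k \Po ((2 / gbar) *: 'X - 1).

Definition cheb_trunc r : {poly R} :=
  (cheb_coef 0 / 2)%:P + \sum_(1 <= k < r.+1) cheb_coef k *: cheb_shift k.

Definition cheb_moment k : R :=
  \int[nu]_(t in `[0, gbar]) (cheb_shift k).[t].

Definition cheb_vol r : R :=
  2 ^+ n * (weight + m)%:R / m%:R *
  (cheb_coef 0 / 2 + \sum_(1 <= k < r.+1) cheb_coef k * cheb_moment k).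

Definition stokes_feasible r p : Prop :=
  [/\ (size p <= (2 * r).+1)%N,
      forall t, t \in `[0, 1] -> stokes_cst * (1 - t) <= p.[t]
    & forall t, t \in `[0, gbar] -> 0 <= p.[t]].

Definition stokes_value r : \bar R :=
  ereal_inf [set (\int[nu]_(t in `[0%R, gbar]) (p.[t])%:E)%E
            | p in stokes_feasible r].

Definition cheb_upper r eps : {poly R} :=
  stokes_cst *: (cheb_trunc r + eps%:P).

Definition cheb_vol_upper r eps : R :=
  cheb_vol r + 2 ^+ n * stokes_cst * eps.

Definition qstar : {poly R} :=
  stokes_cst *: ('X - (weight%:R / (weight + m)%:R)%:P).

End stokes.

Definition is_sos (R : realType) (p : {poly R}) : Prop :=
  exists s : seq {poly R}, p = \sum_(q <- s) q ^+ 2.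

(* Main.v *)
(* The uniform error bound makes f_r + eps dominate the hinge function, and it
   is integrated term by term against nu, a probability concentrated on
   [0, gbar].

   For the certificates, factor a polynomial p that is nonnegative on [a, b]
   into real linear factors and quadratics (X - u)^2 + v^2.  Each linear factor
   without sign change on ]a, b[ is of the form s0 + (X - a)(b - X) s1, the other
   linear factors occur squared, and polynomials of this form are closed under
   multiplication.

   For the volume, write V = vol K.  The weighted dilation x_i |-> t^(w_i) x_i
   multiplies Lebesgue measure by t^|w| and maps K onto {g <= t^m}, so
   vol {g <= u} = u^(|w|/m) V for 0 < u <= 1.  By the layer cake formula the
   integral of (1 - g)_+ over the cube is the integral of u^(|w|/m) V over
   [0, 1], that is m/(|w|+m) V.  Every feasible polynomial dominates
   (|w|+m)/m (1 - t)_+ on [0, gbar]. *)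

From HB Require Import structures.
Require Import Defs.
From mathcomp Require Import all_boot all_order all_algebra.
From mathcomp Require Import all_classical all_reals all_analysis.
From mathcomp Require Import measurable_realfun.
From mathcomp Require mpoly.
From mathcomp Require Import -(notations) complex.
From mathcomp Require Import ring lra zify.

Import Order.TTheory GRing.Theory Num.Theory.
Import numFieldNormedType.Exports.
Local Open Scope classical_set_scope.
Local Open Scope ring_scope.

(** * Sums-of-squares certificates on an interval *)

Section certificates.
Set Implicit Arguments.
Unset Strict Implicit.
Context {R : realType}.
Implicit Types (p q s t : {poly R}) (a b c : R).

Lemma is_sos_sqr p : is_sos (p ^+ 2).
Proof. by exists [:: p]; rewrite big_seq1. Qed.

Lemma is_sos0 : is_sos (0 : {poly R}).
Proof. by exists [::]; rewrite big_nil. Qed.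

Lemma is_sosD p q : is_sos p -> is_sos q -> is_sos (p + q).
Proof. by move=> [s ->] [t ->]; exists (s ++ t); rewrite big_cat. Qed.

Lemma is_sosM p q : is_sos p -> is_sos q -> is_sos (p * q).
Proof.
move=> [s ->] [t ->]; exists [seq x * y | x <- s, y <- t].
rewrite big_allpairs_dep big_distrlr/=.
by apply: eq_bigr => x _; apply: eq_bigr => y _; rewrite exprMn.
Qed.

Lemma is_sosC c : 0 <= c -> is_sos c%:P.
Proof. by move=> c0; rewrite -(sqr_sqrtr c0) rmorphXn; exact: is_sos_sqr. Qed.

(* For d > 0 the bound (2 * d).-1 is the (2 * d - 2).+1 of the theorem; for
   d = 0 it forces s1 = 0. *)
Definition itv_certificate a b d p := exists s0 s1,
  [/\ is_sos s0 /\ is_sos s1, (size s0 <= (2 * d).+1)%N,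
      (size s1 <= (2 * d).-1)%N
    & p = s0 + ('X - a%:P) * (b%:P - 'X) * s1].

Lemma itv_certificate_sos a b d p :
  is_sos p -> (size p <= (2 * d).+1)%N -> itv_certificate a b d p.
Proof.
move=> sp zp; exists p, 0; rewrite mulr0 addr0 size_poly0.
by do 2?split => //; exact: is_sos0.
Qed.

Lemma size_itv_weight a b : (size (('X - a%:P) * (b%:P - 'X))%R <= 3)%N.
Proof.
by rewrite -[b%:P - _]opprB mulrN size_polyN (leq_trans (size_polyMleq _ _))// !size_XsubC.
Qed.

(** With h = (X - a)(b - X), the product (s0 + h s1)(t0 + h t1) equals (s0 t0 + h^2 s1 t1) + h (s0
    t1 + t0 s1), and h^2 is a square. *)
Lemma itv_certificateM a b d e p q :
  itv_certificate a b d p -> itv_certificate a b e q ->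
  itv_certificate a b (d + e) (p * q).
Proof.
set h := ('X - a%:P) * (b%:P - 'X).
(* The predecessor is truncated at 0, so the zero polynomial is treated apart; a nonzero [s] forces
   k > 0. *)
have hs k s : (size s <= (2 * k).-1)%N -> (size (h * s)%R <= (2 * k).+1)%N.
  have [->|s0] := eqVneq s 0; first by rewrite mulr0 size_poly0.
  move=> sk; apply: (leq_trans (size_polyMleq _ _)).
  have arith x y : (x <= 3 -> 0 < y -> y <= (2 * k).-1 ->
      (x + y).-1 <= (2 * k).+1)%N by lia.
  by apply: arith => //; [exact: size_itv_weight|rewrite lt0n size_poly_eq0].
have zM k l s t : (size s <= k.+1)%N -> (size t <= l.+1)%N ->
    (size (s * t)%R <= (k + l).+1)%N.
  move=> sk tl; apply: (leq_trans (size_polyMleq _ _)).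
  have arith x y : (x <= k.+1 -> y <= l.+1 -> (x + y).-1 <= (k + l).+1)%N by lia.
  exact: arith.
have zN k l s t : (size s <= (2 * k).+1)%N -> (size t <= (2 * l).-1)%N ->
    (size (s * t)%R <= (2 * (k + l)).-1)%N.
  have [->|t0] := eqVneq t 0; first by rewrite mulr0 size_poly0.
  move=> sk tl; apply: (leq_trans (size_polyMleq _ _)).
  have arith x y : (x <= (2 * k).+1 -> 0 < y -> y <= (2 * l).-1 ->
      (x + y).-1 <= (2 * (k + l)).-1)%N by lia.
  by apply: arith => //; rewrite lt0n size_poly_eq0.
move=> [s0 [s1 [[ss0 ss1] zs0 zs1 ->]]] [t0 [t1 [[st0 st1] zt0 zt1 ->]]].
exists (s0 * t0 + h ^+ 2 * (s1 * t1)), (s0 * t1 + t0 * s1); split.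
- split; apply: is_sosD; try exact: is_sosM.
  by apply: is_sosM; [exact: is_sos_sqr|exact: is_sosM].
- rewrite (leq_trans (size_polyD _ _))// geq_max mulnDr zM//=.
  rewrite (_ : _ * _ = (h * s1) * (h * t1)); last by ring.
  by apply: zM; exact: hs.
- rewrite (leq_trans (size_polyD _ _))// geq_max zN//=.
  by rewrite addnC zN.
- by rewrite -/h; ring.
Qed.

(** Since X - a and b - X add up to b - a, (b - a)(X - a) = (X - a)^2 + (X - a)(b - X). Divide by b
    - a and add the constant a - c >= 0. *)
Lemma itv_certificate_XsubC a b c : a < b -> c <= a ->
  itv_certificate a b 1 ('X - c%:P).
Proof.
move=> ab ca; have ba : 0 < (b - a)^-1 by rewrite invr_gt0 subr_gt0.
exists ((b - a)^-1%:P * ('X - a%:P) ^+ 2 + (a - c)%:P), (b - a)^-1%:P; split.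
- split; last exact/is_sosC/ltW.
  apply: is_sosD; last by apply: is_sosC; rewrite subr_ge0.
  by apply: is_sosM; [exact/is_sosC/ltW|exact: is_sos_sqr].
- rewrite (leq_trans (size_polyD _ _))// geq_max mul_polyC.
  rewrite (leq_trans (size_scale_leq _ _)) ?size_exp_XsubC//=.
  by rewrite (leq_trans (size_polyC_leq1 _)).
- exact: size_polyC_leq1.
- have e : (b - a)^-1%:P * (b%:P - a%:P) = 1 :> {poly R}.
    by rewrite -polyCB -polyCM mulVf// subr_eq0 gt_eqF.
  rewrite polyCB.
  transitivity ((b - a)^-1%:P * (b%:P - a%:P) * ('X - a%:P) + (a%:P - c%:P)).
    by rewrite e mul1r; ring.
  by ring.
Qed.

(** The mirror image: (b - a)(b - X) = (b - X)^2 + (X - a)(b - X). *)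
Lemma itv_certificate_subCX a b c : a < b -> b <= c ->
  itv_certificate a b 1 (c%:P - 'X).
Proof.
move=> ab bc; have ba : 0 < (b - a)^-1 by rewrite invr_gt0 subr_gt0.
exists ((b - a)^-1%:P * (b%:P - 'X) ^+ 2 + (c - b)%:P), (b - a)^-1%:P; split.
- split; last exact/is_sosC/ltW.
  apply: is_sosD; last by apply: is_sosC; rewrite subr_ge0.
  by apply: is_sosM; [exact/is_sosC/ltW|exact: is_sos_sqr].
- rewrite (leq_trans (size_polyD _ _))// geq_max mul_polyC.
  rewrite -[b%:P - _]opprB sqrrN (leq_trans (size_scale_leq _ _)) ?size_exp_XsubC//=.
  by rewrite (leq_trans (size_polyC_leq1 _)).
- exact: size_polyC_leq1.
- have e : (b - a)^-1%:P * (b%:P - a%:P) = 1 :> {poly R}.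
    by rewrite -polyCB -polyCM mulVf// subr_eq0 gt_eqF.
  rewrite polyCB.
  transitivity ((b - a)^-1%:P * (b%:P - a%:P) * (b%:P - 'X) + (c%:P - b%:P)).
    by rewrite e mul1r; ring.
  by ring.
Qed.

(** By continuity. This gives the sign of a cofactor at a point where the factor split off
    vanishes. *)
Lemma horner_ge0_right p c b : c < b ->
  (forall x, c < x < b -> 0 <= p.[x]) -> 0 <= p.[c].
Proof.
move=> cb pge0; apply: (cvgr_to_ge (F := c^'+) (f := horner p)).
  by apply: cvg_at_right_filter; exact: continuous_horner.
near=> x; apply: pge0; apply/andP; split; near: x.
  exact: nbhs_right_gt.
exact: nbhs_right_lt.
Unshelve. all: by end_near. Qed.

Lemma horner_ge0_left p a c : a < c ->
  (forall x, a < x < c -> 0 <= p.[x]) -> 0 <= p.[c].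
Proof.
move=> ac pge0; apply: (cvgr_to_ge (F := c^'-) (f := horner p)).
  by apply: cvg_at_left_filter; exact: continuous_horner.
near=> x; apply: pge0; apply/andP; split; near: x.
  exact: nbhs_left_gt.
exact: nbhs_left_lt.
Unshelve. all: by end_near. Qed.

(* A pair of conjugate non-real roots contributes the sum of squares
   (X - u)^2 + v^2. *)
Lemma poly_split_factor p : (1 < size p)%N ->
  (exists c, root p c) \/
  (exists u v : R, ('X - u%:P) ^+ 2 + (v ^+ 2)%:P %| p).
Proof.
move=> p1; pose f : {rmorphism R -> complex R} := real_complex R.
(* [complex R] is algebraically closed, so there is a root u + iv. *)
have /closed_rootP[[u v]] : size (map_poly f p) != 1%N.
  by rewrite size_map_poly neq_ltn p1 orbT.
move=> zroot; have [v0|v0] := eqVneq v 0.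
  left; exists u; move: zroot; rewrite v0.
  by rewrite -[Complex u 0]/(f u) fmorph_root.
right; exists u, v; set d := _ + _.
have sd : size d = 3%N.
  rewrite /d size_polyDl ?size_exp_XsubC//.
  by rewrite (leq_ltn_trans (size_polyC_leq1 _)).
have zd : (map_poly f d).[Complex u v] = 0.
  rewrite /d !rmorphD/= rmorphXn/= rmorphB/= map_polyX !map_polyC/=.
  rewrite hornerD horner_exp hornerXsubC hornerC.
  by rewrite /f/=; apply/eqP; rewrite eq_complex/=; apply/andP; split;
    apply/eqP; ring.
(* The remainder modulo [d] has degree at most 1 and still vanishes at u + iv. As v is nonzero, the
   imaginary part kills its slope, then the real part its constant. *)
have : (map_poly f (p %% d)).[Complex u v] = 0.
  move: zroot; rewrite /root {1}(divp_eq p d) rmorphD rmorphM hornerD hornerM zd.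
  by rewrite mulr0 add0r => /eqP.
have : (size (p %% d)%R <= 2)%N by rewrite -ltnS -sd ltn_modp -size_poly_eq0 sd.
rewrite /dvdp; move: (p %% d) => s s2.
have -> : s = s`_1 *: 'X + (s`_0)%:P.
  apply/polyP => -[|[|i]]; rewrite coefD coefZ coefX coefC/= ?mulr0 ?mulr1 ?add0r ?addr0//.
  by rewrite nth_default// (leq_trans s2).
rewrite rmorphD/= map_polyZ/= map_polyX map_polyC/= hornerD hornerZ hornerX hornerC.
move=> /eqP; rewrite eq_complex/= => /andP[/eqP re /eqP im].
have s10 : s`_1 = 0.
  apply: (mulIf v0); rewrite mul0r; move: im; lra.
move: re; rewrite s10 !mul0r subr0 add0r => ->.
by rewrite scale0r addr0.
Qed.

(* The Lukacs decomposition with twice the optimal degree: then every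
   irreducible factor of p, even a linear one, may cost degree two and the
   certificates of the factors can be multiplied. *)
Lemma itv_certificate_ge0 a b d p : a < b -> (size p <= d.+1)%N ->
  (forall x, a < x < b -> 0 <= p.[x]) -> itv_certificate a b d p.
Proof.
move=> ab; elim/ltn_ind: d p => d IHd p pd pge0.
have [p1|p1] := leqP (size p) 1.
  apply: itv_certificate_sos; last by rewrite (leq_trans p1).
  move: pge0; rewrite (size1_polyC p1) => pge0; apply: is_sosC.
  have := pge0 ((a + b) / 2); rewrite hornerC; apply; apply/andP; split; lra.
have p0 : p != 0 by rewrite -size_poly_gt0 (ltn_trans _ p1).
case: d IHd pd => [|d] IHd pd; first by move: (leq_trans p1 pd).
have [[c /factor_theorem[q pE]]|[u [v]]] := poly_split_factor p1.
  have q0 : q != 0 by apply: contraNneq p0 => q0; rewrite pE q0 mul0r.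
  have qd : (size q <= d.+1)%N.
    by move: pd; rewrite pE size_mul ?polyXsubC_eq0// size_XsubC addn2.
  have pxE x : p.[x] = q.[x] * (x - c) by rewrite pE hornerM hornerXsubC.
  (* A root outside ]a, b[ gives a factor of constant sign there; for c >= b both factors are
     negated. *)
  have [ca|ac] := leP c a.
    rewrite pE -addn1; apply: itv_certificateM; last exact: itv_certificate_XsubC.
    apply: IHd => // x /[dup] xab /andP[ax xb]; have := pge0 x xab.
    by rewrite pxE pmulr_lge0// subr_gt0 (le_lt_trans ca).
  have [bc|cb] := leP b c.
    rewrite pE -opprB mulrN -mulNr -addn1; apply: itv_certificateM;
      last exact: itv_certificate_subCX.
    apply: IHd; rewrite ?size_polyN// => x /[dup] xab /andP[ax xb].
    have := pge0 x xab.
    by rewrite hornerN oppr_ge0 pxE nmulr_lge0// subr_lt0 (lt_le_trans xb).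
  (* For a root inside ]a, b[ the factor X - c changes sign, hence so must [q]; thus q(c) = 0 and (X
     - c)^2 divides [p]. *)
  have qright x : c < x < b -> 0 <= q.[x].
    move=> /andP[cx xb]; have := pge0 x; rewrite xb (lt_trans ac cx)/= => /(_ isT).
    by rewrite pxE pmulr_lge0// subr_gt0.
  have qleft x : a < x < c -> 0 <= (- q).[x].
    move=> /andP[ax xc]; have := pge0 x; rewrite ax (lt_trans xc cb)/= => /(_ isT).
    by rewrite pxE nmulr_lge0 ?subr_lt0// hornerN oppr_ge0.
  have /factor_theorem[s qE] : root q c.
    rewrite /root eq_le (horner_ge0_right cb qright) andbT.
    by have := horner_ge0_left ac qleft; rewrite hornerN oppr_ge0.
  have s0 : s != 0 by apply: contraNneq q0 => s0; rewrite qE s0 mul0r.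
  case: d IHd pd qd => [|d] IHd pd qd.
    move: qd; rewrite qE size_mul ?polyXsubC_eq0// size_XsubC addn2/= ltnS leqn0.
    by rewrite size_poly_eq0 (negbTE s0).
  have sd : (size s <= d.+1)%N.
    by move: qd; rewrite qE size_mul ?polyXsubC_eq0// size_XsubC addn2.
  have sright x : c < x < b -> 0 <= s.[x].
    move=> /[dup] /qright + /andP[cx _].
    by rewrite qE hornerM hornerXsubC pmulr_lge0// subr_gt0.
  have sleft x : a < x < c -> 0 <= s.[x].
    move=> /[dup] /qleft + /andP[_ xc].
    by rewrite qE hornerN oppr_ge0 hornerM hornerXsubC nmulr_lle0 ?subr_lt0.
  rewrite pE qE -mulrA -expr2 -[d.+2]addn1.
  apply: itv_certificateM; last first.
    by apply: itv_certificate_sos; [exact: is_sos_sqr|rewrite size_exp_XsubC].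
  apply: IHd => //; first exact: leqW.
  move=> x /andP[ax xb].
  have [xc|cx|->] := ltgtP x c.
  - by apply: sleft; rewrite ax.
  - by apply: sright; rewrite cx.
  - exact: (horner_ge0_right cb sright).
set h := _ + _ => /dvdpP[q pE].
have q0 : q != 0 by apply: contraNneq p0 => q0; rewrite pE q0 mul0r.
have sh : size h = 3%N.
  rewrite /h size_polyDl ?size_exp_XsubC//.
  by rewrite (leq_ltn_trans (size_polyC_leq1 _)).
have h0 : h != 0 by rewrite -size_poly_gt0 sh.
rewrite pE -addn1; apply: itv_certificateM; last first.
  apply: itv_certificate_sos; last by rewrite sh.
  by apply: is_sosD; [exact: is_sos_sqr|exact/is_sosC/sqr_ge0].
(* Since v may be 0 here, [h] is known to be positive only away from u; continuity covers u. *)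
have qge0 x : a < x < b -> x != u -> 0 <= q.[x].
  move=> /pge0 + xu; rewrite pE hornerM pmulr_lge0//.
  rewrite /h hornerD horner_exp hornerXsubC hornerC ltr_pwDl ?sqr_ge0//.
  by rewrite exprn_even_gt0//= subr_eq0.
apply: IHd => //.
  by move: pd; rewrite pE size_mul// sh addn3 => /ltnW.
move=> x xab; have [xu|] := eqVneq x u; last exact: qge0.
case/andP: (xab) => ax xb.
apply: (horner_ge0_right xb) => y /andP[xy yb]; apply: qge0.
  by rewrite (lt_trans ax xy).
by rewrite -xu gt_eqF.
Qed.

End certificates.

(** * Anisotropic scaling of Lebesgue measure *)

Section dilation.
Set Implicit Arguments.
Unset Strict Implicit.
Context {R : realType}.

Definition dilation n (s : 'I_n -> R) (x : n.-tuple R) : n.-tuple R :=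
  [tuple s i * tnth x i | i < n].

Lemma measurable_dilation n (s : 'I_n -> R) :
  measurable_fun [set: n.-tuple R] (dilation s).
Proof.
apply/measurable_fun_tnthP => i.
apply: (eq_measurable_fun (fun x : n.-tuple R => s i * tnth x i)).
  by move=> x _ /=; rewrite tnth_mktuple.
by apply: measurable_funM => //; exact: measurable_tnth.
Qed.

(** Both sides are measures in A that agree on half-open intervals, which determines Lebesgue
    measure. *)
Lemma lebesgue_measure_scale (s : R) (A : set R) : 0 < s -> measurable A ->
  lebesgue_measure A =
  (s%:E * lebesgue_measure ((fun x : R => s * x)%R @^-1` A))%E.
Proof.
move=> s0 mA.
pose mul_s : measurableTypeR R -> measurableTypeR R := fun x => s * x.
have mf : measurable_fun setT mul_s by exact: measurable_funM.
pose mu : {measure set (measurableTypeR R) -> \bar R} :=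
  mscale (NngNum (ltW s0)) (pushforward lebesgue_measure mul_s).
apply: (@lebesgue_measure_unique R (mu mf)) => // _ [[a b]] _ <-.
rewrite /mu /= /mscale /= /pushforward.
rewrite (_ : mul_s @^-1` _ = `]a / s, b / s]%classic); last first.
  apply/seteqP; split => x /=; rewrite /mul_s !in_itv/=;
    by rewrite ltr_pdivrMr// ler_pdivlMr// [x * s]mulrC.
rewrite !lebesgue_measure_itv/= !lte_fin ltr_pM2r ?invr_gt0//.
case: ifPn => _; last by rewrite mule0.
by rewrite -!EFinB -EFinM -mulrBl mulrCA divff ?mulr1 ?gt_eqF.
Qed.

(** Induction on n: the rescaled image of the product measure agrees with it on rectangles, by the
    one-dimensional case and the induction hypothesis, and rectangles determine the product
    measure. *)
Lemma lebesgue_tuple_dilation n (s : 'I_n -> R) (A : set (n.-tuple R)) :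
  (forall i, 0 < s i) -> measurable A ->
  lebesgue_tuple R n A =
  ((\prod_i s i)%:E * lebesgue_tuple R n (dilation s @^-1` A))%E.
Proof.
elim: n s A => [|n IHn] s A s0 mA.
  rewrite big_ord0 mul1e; congr (lebesgue_tuple R 0 _).
  by apply/seteqP; split => x /=; rewrite (tuple0 x) (tuple0 (dilation s _)).
pose s' i := s (lift ord0 i).
have s'0 i : 0 < s' i by exact: s0.
(* The dilation by [s], read through [tcons] on R x R^n. *)
pose psi : measurableTypeR R * n.-tuple R -> measurableTypeR R * n.-tuple R :=
  fun p => (s ord0 * p.1, dilation s' p.2).
have mpsi : measurable_fun setT psi.
  apply/measurable_fun_pairP; split => /=.
    by apply: measurable_funM => //; exact: measurable_fst.
  apply: (measurableT_comp (f := dilation s')); last exact: measurable_snd.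
  exact: measurable_dilation.
have c0 : 0 <= \prod_i s i by apply: prodr_ge0 => i _; exact/ltW.
pose mu : {measure set (measurableTypeR R * n.-tuple R) -> \bar R} :=
  mscale (NngNum c0) (pushforward (@lebesgue_measure R \x lebesgue_tuple R n)%E psi).
have mtcons : measurable (@tcons R n @^-1` A).
  exact: (measurable_funPTI (@tcons R n)).
have -> : lebesgue_tuple R n.+1 A = mu mpsi (@tcons R n @^-1` A).
  apply: (@product_measure_unique _ _ _ _ R (@lebesgue_measure R)
    (lebesgue_tuple R n) (mu mpsi)) => // X Y mX mY.
  rewrite /mu /= /mscale /= /pushforward.
  have -> : psi @^-1` (X `*` Y) =
      ((fun x : R => s ord0 * x) @^-1` X) `*` (dilation s' @^-1` Y) by [].
  rewrite product_measure1E; last 2 first.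
  - rewrite -[X in measurable X]setTI.
    by apply: (_ : measurable_fun setT _) => //; exact: measurable_funM.
  - rewrite -[X in measurable X]setTI.
    exact: measurable_dilation.
  rewrite (lebesgue_measure_scale (s0 ord0) mX) (IHn _ _ s'0 mY).
  by rewrite big_ord_recl EFinM muleACA.
have tE p : tcons (psi p) = dilation s (tcons p).
  apply: eq_from_tnth => i; rewrite tnth_mktuple /tcons.
  have [->|i0] := eqVneq i ord0; first by [].
  have [j ->] : exists j, i = lift ord0 j.
    by case: (unliftP ord0 i) i0 => [j ->|->]; [exists j|rewrite eqxx].
  by rewrite !tnthS tnth_mktuple.
rewrite /mu /= /mscale /= /pushforward -[psi @^-1` _]/[set x | A (tcons (psi x))].
by congr (_ * _)%E; congr product_measure1; apply: eq_set => p; rewrite tE.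
Qed.

End dilation.

(** * The lower bound by the volume *)

Section stokes_bound.
Set Implicit Arguments.
Unset Strict Implicit.
Context {R : realType}.

(** The primitive is -(1 - x)^(a + 1) / (a + 1). Stopping at 1 - d keeps the base of the power
    positive, where it is differentiable. *)
Lemma integral_powR_onem (a d : R) : 0 <= a -> 0 < d < 1 ->
  (\int[lebesgue_measure]_(x in `[0%R, (1 - d)%R]) ((1 - x) `^ a)%:E =
   ((1 - d `^ (a + 1)) / (a + 1))%:E)%E.
Proof.
move=> a0 /andP[d0 d1]; have a1 : a + 1 != 0 by rewrite gt_eqF// ltr_wpDl.
have dpow (b x : R) : x < 1 ->
    is_derive x 1 (fun x : R => (1 - x) `^ b) (- (b * (1 - x) `^ (b - 1))).
  move=> x1; have x10 : 0 < 1 - x by rewrite subr_gt0.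
  have dP := is_derive1_powR b x10.
  have dB : is_derive x 1 (fun x : R => 1 - x) (-1).
    by apply: is_derive_eq; rewrite add0r mul1r.
  have := @is_derive1_comp R (fun y => y `^ b) (fun y => 1 - y) x _ _ dP dB.
  by move=> /is_derive_eq; apply; rewrite mulrN1.
have cpow (b x : R) : x < 1 -> {for x, continuous (fun x : R => (1 - x) `^ b)}.
  by move=> /(dpow b) [dx _]; exact/differentiable_continuous/derivable1_diffP.
pose F (x : R) := - (a + 1)^-1 * (1 - x) `^ (a + 1).
have dF (x : R) : x < 1 -> is_derive x 1 F ((1 - x) `^ a).
  move=> x1; have := is_deriveZ (- (a + 1)^-1) (dpow (a + 1) x x1).
  move=> /is_derive_eq; apply.
  by rewrite addrK /GRing.scale/= mulrNN mulrA mulVf// mul1r.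
have cF (x : R) : x < 1 -> {for x, continuous F}.
  by move=> /dF[dx _]; exact/differentiable_continuous/derivable1_diffP.
have dd : 1 - d < 1 by rewrite gtrBl.
rewrite (@continuous_FTC2 _ _ F).
- rewrite /F subr0 powR1 subKr -EFinB; by congr (_%:E); field.
- by rewrite subr_gt0.
- apply: continuous_in_subspaceT => x; rewrite inE/= in_itv/= => /andP[_ xd].
  by apply: cpow; exact: le_lt_trans dd.
- split.
  + move=> x; rewrite in_itv/= => /andP[_ xd].
    by have [] := dF x (lt_trans xd dd).
  + by apply: cvg_at_right_filter; exact: cF.
  + by apply: cvg_at_left_filter; exact: cF.
- move=> x; rewrite in_itv/= => /andP[_ xd].
  by rewrite derive1E; have [_] := dF x (lt_trans xd dd).
Qed.

Lemma measurable_hinge : measurable_fun [set: R] (@hinge R).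
Proof.
apply: measurable_maxr; first exact: measurable_cst.
exact: measurable_funB.
Qed.

HB.instance Definition _ := isMeasurableFun.Build _ _ _ _ (@hinge R) measurable_hinge.

Lemma hinge_ge0 (t : R) : 0 <= hinge t.
Proof. by rewrite /hinge le_max lexx. Qed.

Context {n m : nat} {w : 'I_n -> nat} {g : mpoly.mpoly n R}.
Context (hm : (0 < m)%N) (g_ge0 : forall x : n.-tuple R, 0 <= mpeval g x)
    (g_homog : forall (t : R) (x : n.-tuple R), 0 < t ->
       mpeval g [tuple t ^+ w i * tnth x i | i < n] = t ^+ m * mpeval g x)
    (K_sub : sublevel g `<=` cube R n)
    (gbar_gt1 : 1 < gbar g).
Local Notation W := (weight w).
Local Notation vol := (lebesgue_tuple R n).

Lemma measurable_mpeval_le (u : R) : measurable [set x | mpeval g x <= u].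
Proof.
have -> : [set x | mpeval g x <= u] = mpeval g @^-1` `]-oo, u].
  by apply/seteqP; split => x /=; rewrite in_itv.
exact: measurable_funPTI.
Qed.

(** By homogeneity, the preimage of {g <= t^m} under the weighted dilation is K; the factors t^(w_i)
    multiply to t^|w|. *)
Lemma sublevel_scaling (t : R) : 0 < t ->
  vol [set x | mpeval g x <= t ^+ m] = ((t ^+ W)%:E * vol (sublevel g))%E.
Proof.
move=> t0; rewrite (@lebesgue_tuple_dilation _ _ (fun i => t ^+ w i)); last 2 first.
- by move=> i; exact: exprn_gt0.
- exact: measurable_mpeval_le.
rewrite prodrXr; congr (_ * _)%E; congr (lebesgue_tuple R n _).
apply/seteqP; split => x /=; by rewrite /sublevel/= g_homog// ger_pMr ?exprn_gt0.
Qed.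

(* The tail event is {g < 1 - r}; the factor q < 1 leaves room to replace it by
   a closed sublevel set, to which sublevel_scaling applies. *)
Lemma ccdf_hinge_ge (q r : R) : 0 < q < 1 -> 0 <= r < 1 ->
  ((q ^+ W * (1 - r) `^ (W%:R / m%:R) / 2 ^+ n)%:E * vol (sublevel g)
    <= ccdf (P := uniform_cube R n) (@hinge R \o mpeval g) r)%E.
Proof.
move=> /andP[q0 q1] /andP[r0 r1]; have r10 : 0 < 1 - r by rewrite subr_gt0.
(* Chosen so that t^m = q^m (1 - r) < 1 - r, which makes {g <= t^m} part of the tail event. *)
pose t := q * (1 - r) `^ (m%:R^-1).
have t0 : 0 < t by rewrite mulr_gt0// powR_gt0.
have tm : t ^+ m < 1 - r.
  rewrite exprMn -(@powR_mulrn _ (_ `^ _) m) ?powR_ge0// -powRrM mulVf ?pnatr_eq0 -?lt0n//.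
  by rewrite powRr1 ?ltW// -[ltRHS]mul1r ltr_pM2r// exprn_ilt1 ?(ltW q0)// -lt0n.
have tm1 : t ^+ m <= 1 by rewrite ltW// (lt_le_trans tm)// gerBl.
have tW : t ^+ W = q ^+ W * (1 - r) `^ (W%:R / m%:R).
  by rewrite exprMn -(@powR_mulrn _ (_ `^ _) W) ?powR_ge0// -powRrM [_ / _]mulrC.
rewrite -tW [(_ / _)%:E]EFinM muleAC -sublevel_scaling//.
rewrite /ccdf /distribution /= /pushforward uniform_cubeE lee_pmul2r ?lte_fin ?invr_gt0 ?exprn_gt0//.
apply: le_measure; rewrite ?inE.
- exact: measurable_mpeval_le.
- apply: measurableI; last exact: measurable_cube.
  exact: (measurable_funPTI (@hinge R \o mpeval g)).
- move=> x /= xt; split; last by apply: K_sub; exact: le_trans tm1.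
  rewrite /= in_itv/= andbT /hinge lt_max; apply/orP; right.
  by rewrite ltrBrDr -ltrBrDl (le_lt_trans xt).
Qed.

(** Layer cake: the integral is that of the tail probabilities. The constant m/(|w|+m) is the
    integral of (1 - r)^(|w|/m) over [0, 1]. *)
Lemma integral_hinge_ge :
  ((m%:R / (W + m)%:R / 2 ^+ n)%:E * vol (sublevel g)
    <= \int[nu g]_(t in `[0%R, gbar g]) (hinge t)%:E)%E.
Proof.
have -> : (\int[nu g]_(t in `[0%R, gbar g]) (hinge t)%:E =
    'E_(uniform_cube R n)[@hinge R \o mpeval g])%E.
  rewrite expectation_def /nu ge0_integral_pushforward//.
  (* Where g exceeds [gbar] > 1 the hinge vanishes, so restricting to [0, gbar] changes nothing. *)
  - rewrite integral_mkcond; apply: eq_integral => x _ /=.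
    rewrite patchE; case: ifPn => //; rewrite notin_setE/= in_itv/= g_ge0/=.
    move=> /negP; rewrite -ltNge => xg; rewrite /hinge max_l// subr_le0.
    by rewrite ltW// (lt_trans gbar_gt1).
  - apply/measurable_EFinP/measurable_funTS; exact: measurable_hinge.
  - by move=> t _; rewrite lee_fin hinge_ge0.
rewrite ge0_expectation_ccdf; last by move=> x; exact: hinge_ge0.
have Vfin : vol (sublevel g) \is a fin_num.
  rewrite ge0_fin_numE//.
  apply: (@le_lt_trans _ _ (vol (cube R n))); last by rewrite lebesgue_cube ltry.
  by apply: le_measure; rewrite ?inE//; [exact: measurable_mpeval_le|exact: measurable_cube].
(* Lose a factor r = q^(W+1) < 1: the W factors q come from ccdf_hinge_ge, the
   last one from integrating over [0, q] only, where the integrand is smooth. *)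
apply/lee_mul01Pr => [|r /andP[r0 r1]].
  by rewrite mule_ge0// lee_fin !divr_ge0// ?exprn_ge0.
pose q := r `^ (W.+1%:R^-1).
have q0 : 0 < q by rewrite powR_gt0.
have qr : q ^+ W.+1 = r.
  by rewrite -powR_mulrn ?powR_ge0// -powRrM mulVf ?pnatr_eq0// powRr1// ltW.
have q1 : q < 1.
  rewrite ltNge; apply/negP => q1; move: r1.
  by rewrite -qr ltNge exprn_ege1.
set a : R := W%:R / m%:R.
have a0 : 0 <= a by rewrite divr_ge0.
have mpow : measurable_fun [set: R] (fun x : R => (1 - x) `^ a).
  apply: (measurableT_comp (f := fun x : R => x `^ a)) => //.
  exact: measurable_funB.
pose v := fine (vol (sublevel g)).
have v0 : 0 <= v by exact: fine_ge0.
pose k := q ^+ W / 2 ^+ n * v.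
have k0 : 0 <= k by rewrite mulr_ge0// divr_ge0 ?exprn_ge0// ltW.
(* The end q is written 1 - (1 - q) to match [integral_powR_onem] with d = 1 - q. *)
apply: (@le_trans _ _ (\int[lebesgue_measure]_(x in `[0%R, (1 - (1 - q))%R])
    (k%:E * ((1 - x) `^ a)%:E)))%E.
  rewrite ge0_integralZl_EFin//; last 2 first.
  - by move=> x _; rewrite lee_fin powR_ge0.
  - exact/measurable_EFinP/measurable_funTS.
  rewrite integral_powR_onem//; last by rewrite subr_gt0 q1 gtrBl.
  rewrite -(fineK Vfin) -/v -!EFinM lee_fin.
  have aE : m%:R / (W + m)%:R = (a + 1)^-1.
    rewrite /a natrD; field; rewrite pnatr_eq0 -lt0n hm/=.
    by rewrite -natrD pnatr_eq0 addn_eq0 negb_and -!lt0n hm orbT.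
  (* Hence 1 - (1 - q)^(a + 1) >= q, the last factor q. *)
  have powle : (1 - q) `^ (a + 1) <= 1 - q.
    have nz : (a + 1 == 0) ==> (1 - q != 0).
      by apply/implyP => _; rewrite subr_eq0 gt_eqF.
    rewrite (powRD nz) powRr1 ?subr_ge0 ?(ltW q1)//.
    rewrite ler_piMl ?subr_ge0 ?(ltW q1)//.
    have p1 : 1 `^ a = 1 :> R by rewrite powR1.
    by rewrite -[leRHS]p1 ge0_ler_powR ?nnegrE ?subr_ge0 ?(ltW q1)// gerBl ltW.
  rewrite aE -qr exprSr /k.
  have -> : q ^+ W * q * ((a + 1)^-1 / 2 ^+ n * v) =
      q ^+ W / 2 ^+ n * v * (q / (a + 1)) by ring.
  rewrite ler_wpM2l// ler_pM2r ?invr_gt0 ?ltr_wpDl//.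
  by rewrite lerBrDr -lerBrDl.
apply: (@le_trans _ _ (\int[lebesgue_measure]_(x in `[0%R, (1 - (1 - q))%R])
   ccdf (P := uniform_cube R n) (@hinge R \o mpeval g) x))%E.
  apply: ge0_le_integral => //.
  - by move=> x _; rewrite -EFinM lee_fin mulr_ge0// powR_ge0.
  - apply/measurable_EFinP/measurable_funTS; exact: measurable_funM.
  - by apply: measurable_funTS; exact: ccdf_measurable.
  - move=> x /=; rewrite in_itv/= subKr => /andP[x0 xq].
    have := @ccdf_hinge_ge q x; rewrite q0 q1 x0 (le_lt_trans xq q1) => /(_ isT isT).
    apply: le_trans; rewrite -(fineK Vfin) -/v -!EFinM lee_fin /k -/a.
    by rewrite le_eqVlt; apply/orP; left; apply/eqP; ring.
apply: ge0_subset_integral => //.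
- by apply: measurable_funTS; exact: ccdf_measurable.
- by move=> x /=; rewrite !in_itv/= => /andP[-> _].
Qed.

Lemma hinge_feasible r (p : {poly R}) t : stokes_feasible w m g r p ->
  t \in `[0, gbar g] -> stokes_cst R w m * hinge t <= p.[t].
Proof.
move=> [_ p1 p0] /[dup] tg; rewrite in_itv/= => /andP[t0 _].
rewrite /hinge; have [t1|t1] := leP 0 (1 - t); last by rewrite mulr0 p0.
by apply: p1; rewrite in_itv/= t0 -subr_ge0.
Qed.

(** The constant [stokes_cst] is inverse to m/(|w|+m), so the bound on the hinge integral becomes
    vol K after multiplication by 2^n [stokes_cst]. *)
Lemma sublevel_le_feasible r (p : {poly R}) : stokes_feasible w m g r p ->
  (vol (sublevel g) <=
   (2 ^+ n)%:E * \int[nu g]_(t in `[0%R, gbar g]) (p.[t])%:E)%E.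
Proof.
move=> pf; have C0 : 0 <= stokes_cst R w m by rewrite divr_ge0.
apply: (@le_trans _ _ ((2 ^+ n)%:E * ((stokes_cst R w m)%:E *
    \int[nu g]_(t in `[0%R, gbar g]) (hinge t)%:E)))%E.
  have -> : vol (sublevel g) = ((2 ^+ n)%:E * ((stokes_cst R w m)%:E *
      ((m%:R / (W + m)%:R / 2 ^+ n)%:E * vol (sublevel g))))%E.
    rewrite !muleA -!EFinM -[LHS]mul1e; congr (_%:E * _)%E.
    rewrite /stokes_cst natrD; field.
    rewrite -natrD !pnatr_eq0 addn_eq0 negb_and -!lt0n hm orbT/=.
    by rewrite expf_neq0 ?pnatr_eq0.
  apply: lee_wpmul2l; first by rewrite lee_fin exprn_ge0.
  by apply: lee_wpmul2l; [rewrite lee_fin|exact: integral_hinge_ge].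
apply: lee_wpmul2l; first by rewrite lee_fin exprn_ge0.
have mh : measurable_fun `[0, gbar g]%classic (fun t : R => (hinge t)%:E).
  by apply/measurable_EFinP/measurable_funTS; exact: measurable_hinge.
rewrite -ge0_integralZl_EFin//; last by move=> t _; rewrite lee_fin hinge_ge0.
apply: ge0_le_integral => //.
- by move=> t _; rewrite -EFinM lee_fin mulr_ge0// hinge_ge0.
- exact: measurable_funeM.
- by apply/measurable_EFinP; exact: measurable_poly.
- by move=> t tg; rewrite -EFinM lee_fin; exact: hinge_feasible pf _.
Qed.

End stokes_bound.

(** * The Chebyshev truncation *)

Section chebyshev.
Set Implicit Arguments.
Unset Strict Implicit.
Context {R : realType}.

Lemma size_chebT k : (size (chebT R k) <= k.+1)%N.
Proof.
elim/ltn_ind: k => -[|[|k]] IHk; rewrite ?size_poly1 ?size_polyX//=.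
rewrite -/(chebT R k.+1) (leq_trans (size_polyD _ _))// geq_max size_polyN.
apply/andP; split; last by apply: (leq_trans (IHk k _)); lia.
rewrite -scalerAl (leq_trans (size_scale_leq _ _))//.
rewrite (leq_trans (size_polyMleq _ _))// size_polyX add2n/= ltnS.
exact: IHk.
Qed.

Lemma horner_bounded (p : {poly R}) (b : R) :
  exists M, forall t, `|t| <= b -> `|p.[t]| <= M.
Proof.
exists (\sum_(i < size p) `|p`_i| * b ^+ i) => t tb.
rewrite horner_coef (le_trans (ler_norm_sum _ _ _))//; apply: ler_sum => i _.
by rewrite normrM normrX ler_wpM2l// lerXn2r// nnegrE (le_trans _ tb).
Qed.

Lemma hinge_le1 (t : R) : 0 <= t -> hinge t <= 1.
Proof. by move=> t0; rewrite /hinge ge_max ler01 gerBl. Qed.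

Context {n m : nat} {w : 'I_n -> nat} {g : mpoly.mpoly n R}.

(** Monomials have absolute value at most 1 on the cube. Boundedness makes the supremum [gbar] a
    genuine upper bound. *)
Lemma mpeval_cube_bounded : has_ubound (mpeval g @` cube R n).
Proof.
exists (\sum_(k <- mpoly.msupp g) `|mpoly.mcoeff k g|) => _ [x xB <-].
rewrite /mpeval mpoly.mevalE (le_trans (ler_norm _))//.
rewrite (le_trans (ler_norm_sum _ _ _))//; apply: ler_sum => k _.
rewrite normrM ler_piMr// normr_prod prodr_ile1// => i _.
rewrite normr_ge0 normrX exprn_ile1//.
by have := xB i; rewrite in_itv/= ler_norml.
Qed.

Lemma mpeval_le_gbar x : cube R n x -> mpeval g x <= gbar g.
Proof. by move=> xB; apply: (ub_le_sup mpeval_cube_bounded); exists x. Qed.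

Lemma size_cheb_trunc r : (size (cheb_trunc g r) <= r.+1)%N.
Proof.
rewrite (leq_trans (size_polyD _ _))// geq_max.
rewrite (leq_trans (size_polyC_leq1 _))//=.
rewrite big_nat; apply: (leq_trans (size_sum _ _ _)).
apply/bigmax_leqP_seq => k _ /andP[_ kr].
rewrite (leq_trans (size_scale_leq _ _))// (leq_trans (size_comp_poly_leq _ _))//.
have arith x y : (x <= k.+1 -> y <= 2 -> (x.-1 * y.-1).+1 <= r.+1)%N by nia.
apply: arith; first exact: size_chebT.
rewrite (leq_trans (size_polyD _ _))// geq_max size_polyN size_poly1 andbT.
by rewrite (leq_trans (size_scale_leq _ _))// size_polyX.
Qed.

Context (g_ge0 : forall x : n.-tuple R, 0 <= mpeval g x).

Lemma nu_itv : nu g `[0, gbar g]%classic = 1%E.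
Proof.
rewrite /nu /distribution /= /pushforward uniform_cubeE.
rewrite (_ : _ `&` _ = cube R n); last first.
  apply/seteqP; split => x /=; first by case.
  by move=> xB; split=> //; rewrite in_itv/= g_ge0 mpeval_le_gbar.
by rewrite lebesgue_cube -EFinM divff// expf_eq0 pnatr_eq0 andbF.
Qed.

Lemma nu_integrable_horner (p : {poly R}) :
  (nu g).-integrable `[0, gbar g]%classic (EFin \o horner p).
Proof.
apply: measurable_bounded_integrable => //.
- by apply: (le_lt_trans (probability_le1 _ _)); rewrite ?ltry.
- exact: measurable_poly.
have [M pM] := horner_bounded p (gbar g).
exists M; split; first exact: num_real.
move=> y My t /=; rewrite in_itv/= => /andP[t0 tg].
by rewrite (le_trans _ (ltW My))// pM// ger0_norm.
Qed.

(** This functional is linear and, [nu] having mass 1 on [0, gbar], maps a constant to itself; the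
    moments in [cheb_vol] are its values on [cheb_shift]. *)
Let I (p : {poly R}) := \int[nu g]_(t in `[0, gbar g]) p.[t].

Let ID p q : I (p + q) = I p + I q.
Proof.
rewrite /I -RintegralD//; [|exact: nu_integrable_horner..].
by apply: eq_Rintegral => t _; rewrite hornerD.
Qed.

Let IZ c p : I (c *: p) = c * I p.
Proof.
rewrite /I -RintegralZl//; last exact: nu_integrable_horner.
by apply: eq_Rintegral => t _; rewrite hornerZ.
Qed.

Let IC c : I c%:P = c.
Proof.
transitivity (\int[nu g]_(t in `[0, gbar g]) c).
  by apply: eq_Rintegral => t _; rewrite hornerC.
by rewrite Rintegral_cst// -[RHS]mulr1; congr (_ * _); exact: (congr1 fine nu_itv).
Qed.

Lemma integral_cheb_upper r eps :
  ((2 ^+ n)%:E * \int[nu g]_(t in `[0%R, gbar g]) ((cheb_upper w m g r eps).[t])%:E =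
   (cheb_vol w m g r + 2 ^+ n * stokes_cst R w m * eps)%:E)%E.
Proof.
have -> : (\int[nu g]_(t in `[0%R, gbar g]) ((cheb_upper w m g r eps).[t])%:E)%E =
    (I (cheb_upper w m g r eps))%:E.
  by rewrite /I /Rintegral fineK//; exact: integrable_fin_num (nu_integrable_horner _).
rewrite -EFinM; congr _%:E.
rewrite /cheb_upper /cheb_trunc /cheb_vol IZ !ID !IC.
have -> : I (\sum_(1 <= k < r.+1) cheb_coef g k *: cheb_shift g k) =
    \sum_(1 <= k < r.+1) cheb_coef g k * cheb_moment g k.
  have I0 : I 0 = 0 by exact: IC.
  rewrite (big_morph I ID I0); apply: eq_bigr => k _; exact: IZ.
by rewrite /stokes_cst; ring.
Qed.

End chebyshev.

(** * Feasibility, certificates and value of the shifted Chebyshev truncation *)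

Theorem theorem6 (R : realType) (n m : nat) (w : 'I_n -> nat)
    (g : mpoly.mpoly n R)
    (hn : (0 < n)%N) (hm : (0 < m)%N) (hw : forall i, (0 < w i)%N)
    (g_ge0 : forall x : n.-tuple R, 0 <= mpeval g x)
    (g_homog : forall (t : R) (x : n.-tuple R), 0 < t ->
       mpeval g [tuple t ^+ w i * tnth x i | i < n] = t ^+ m * mpeval g x)
    (g_gt0 : forall x : n.-tuple R, x <> [tuple 0 | _ < n] -> 0 < mpeval g x)
    (K_sub : sublevel g `<=` cube R n)
    (gbar_gt1 : 1 < gbar g)
    (r : nat) (hr : (0 < r)%N) (eps : R)
    (heps : sup [set `|hinge t - (cheb_trunc g r).[t]| | t in `[0, gbar g]]
            <= eps) :
  let C := stokes_cst R w m in
  let p := cheb_upper w m g r eps in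
  let v := cheb_vol_upper w m g r eps in
  [/\ (* feasibility *)
      [/\ forall t, t \in `[0, gbar g] -> C * hinge t <= p.[t],
          (forall t, t \in `[0, 1] -> C * (1 - t) <= p.[t]) /\
          (forall t, t \in `[0, gbar g] -> 0 <= p.[t]),
          (forall t, t \in `[0, 1] -> 1 <= (p + qstar R w m).[t]) /\
          (forall t, t \in `[0, gbar g] -> 0 <= p.[t])
        & stokes_feasible w m g r p],
      (* sum-of-squares certificates *)
      exists sigma0 sigma1 tau0 tau1 : {poly R},
        [/\ [/\ is_sos sigma0, is_sos sigma1, is_sos tau0 & is_sos tau1],
            [/\ (size sigma0 <= (2 * r).+1)%N, (size tau0 <= (2 * r).+1)%N,
                (size sigma1 <= (2 * r - 2).+1)%N
              & (size tau1 <= (2 * r - 2).+1)%N],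
            p = sigma0 + 'X * ((gbar g)%:P - 'X) * sigma1
          & p - C *: (1 - 'X) = tau0 + 'X * (1 - 'X) * tau1]
    & (* value *)
      [/\ ((2 ^+ n)%:E * \int[nu g]_(t in `[0%R, gbar g]) (p.[t])%:E)%E
            = (cheb_vol w m g r + 2 ^+ n * C * eps)%:E,
          cheb_vol w m g r + 2 ^+ n * C * eps = v,
          (lebesgue_tuple R n (sublevel g) <= v%:E)%E
        & (lebesgue_tuple R n (sublevel g)
             <= (2 ^+ n)%:E * stokes_value w m g r)%E /\
          ((2 ^+ n)%:E * stokes_value w m g r <= v%:E)%E]].
Proof.
move=> C p v.
have W0 : (0 < weight w + m)%N by rewrite addn_gt0 hm orbT.
have C0 : 0 < C by rewrite divr_gt0 ?ltr0n.
(* The supremum in [heps] bounds each error once the set of errors is bounded: the hinge is at most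
   1 and the truncation is a polynomial. *)
have err t : t \in `[0, gbar g] -> `|hinge t - (cheb_trunc g r).[t]| <= eps.
  move=> tg; apply: le_trans heps; apply: ub_le_sup; last by exists t.
  have [M pM] := horner_bounded (cheb_trunc g r) (gbar g).
  exists (1 + M) => _ [s sg <-].
  move: sg; rewrite /= in_itv/= => /andP[s0 sg].
  rewrite (le_trans (ler_normB _ _))// lerD ?pM ?ger0_norm ?hinge_ge0//.
  exact: hinge_le1.
have pE t : p.[t] = C * ((cheb_trunc g r).[t] + eps).
  by rewrite hornerZ hornerD hornerC.
have p_hinge t : t \in `[0, gbar g] -> C * hinge t <= p.[t].
  move=> /err; rewrite ler_norml => /andP[_ h].
  by rewrite pE ler_pM2l// -lerBlDl.
have p_ge0 t : t \in `[0, gbar g] -> 0 <= p.[t].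
  by move=> /p_hinge; apply: le_trans; rewrite mulr_ge0 ?hinge_ge0// ltW.
have p_lin t : t \in `[0, 1] -> C * (1 - t) <= p.[t].
  rewrite in_itv/= => /andP[t0 t1]; apply: le_trans (p_hinge t _).
    by rewrite ler_pM2l// /hinge le_max lexx orbT.
  by rewrite in_itv/= t0 (le_trans t1)// ltW.
(* Degree r, half of what (S) allows, is what yields certificates of degree 2r. *)
have size_p : (size p <= r.+1)%N.
  rewrite (leq_trans (size_scale_leq _ _))// (leq_trans (size_polyD _ _))//.
  rewrite geq_max; apply/andP; split; first exact: size_cheb_trunc.
  exact: leq_trans (size_polyC_leq1 _) _.
have feas : stokes_feasible w m g r p.
  by split => //; rewrite (leq_trans size_p)// ltnS leq_pmull.
have value : ((2 ^+ n)%:E * \int[nu g]_(t in `[0%R, gbar g]) (p.[t])%:E)%E =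
    (cheb_vol w m g r + 2 ^+ n * C * eps)%:E.
  exact: integral_cheb_upper.
have bound q : stokes_feasible w m g r q -> (lebesgue_tuple R n (sublevel g) <=
    (2 ^+ n)%:E * \int[nu g]_(t in `[0%R, gbar g]) (q.[t])%:E)%E.
  exact: sublevel_le_feasible.
have n2 : 0 < 2 ^+ n :> R by rewrite exprn_gt0.
split.
- split=> //; split=> // t /p_lin; rewrite hornerD.
  rewrite [(qstar _ _ _).[t]]hornerZ hornerD hornerX hornerN hornerC.
  (* So C (1 - t) and the value of [qstar] at t add up to 1. *)
  have : C * (1 - (weight w)%:R / (weight w + m)%:R) = 1.
    rewrite /C /stokes_cst natrD; field.
    by rewrite -natrD !pnatr_eq0 -!lt0n hm W0.
  by rewrite -/C; set a := _ / _; lra.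
- have gbar0 : 0 < gbar g by exact: lt_trans ltr01 gbar_gt1.
  have [|s0 [s1 [[ss0 ss1] zs0 zs1 pS]]] :=
      @itv_certificate_ge0 R 0 (gbar g) r p gbar0 size_p.
    by move=> x /andP[x0 xg]; apply: p_ge0; rewrite in_itv/= !ltW.
  have [||t0 [t1 [[st0 st1] zt0 zt1 pT]]] :=
      @itv_certificate_ge0 R 0 1 r (p - C *: (1 - 'X)) ltr01.
  + rewrite (leq_trans (size_polyD _ _))// geq_max size_p size_polyN.
    rewrite (leq_trans (size_scale_leq _ _))// -opprB size_polyN size_XsubC.
    by rewrite ltnS.
  + move=> x /andP[x0 x1]; rewrite hornerD hornerN subr_ge0.
    have -> : (C *: (1 - 'X)).[x] = C * (1 - x) by rewrite !hornerE.
    by apply: p_lin; rewrite in_itv/= !ltW.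
  (* Uses r > 0, since natural subtraction is truncated. *)
  have e2r : (2 * r - 2).+1 = (2 * r).-1 by lia.
  exists s0, s1, t0, t1; split; rewrite ?e2r//.
  + by rewrite pS subr0.
  + by rewrite pT subr0.
- split=> //.
  + by rewrite -value; exact: bound.
  + split.
    (* With 2^n factored out, it suffices that 2^(-n) vol K is a lower bound of the set whose
       infimum is taken. *)
    * have -> : lebesgue_tuple R n (sublevel g) =
          ((2 ^+ n)%:E * ((2 ^+ n)^-1%:E * lebesgue_tuple R n (sublevel g)))%E.
        by rewrite muleA -EFinM divff ?gt_eqF// mul1e.
      apply: lee_wpmul2l; first by rewrite lee_fin ltW.
      apply: le_ereal_inf_tmp => _ [q qf <-].
      rewrite -(@lee_pmul2l _ (2 ^+ n)%:E) ?lte_fin//.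
      by rewrite muleA -EFinM divff ?gt_eqF// mul1e; exact: (bound q qf).
    * rewrite -value; apply: lee_wpmul2l; first by rewrite lee_fin ltW.
      by apply: ereal_inf_lbound; exists p.
Qed.
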